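(* Let $f:\mathbb{R}_{\geq 0}\to\mathbb{R}_{\geq 0}$ be a non-decreasing function. Then any monotone class of graphs $\mathcal{X}$ with speed $|\mathcal{X}_n|=2^{O(nf(n))}$ admits an adjacency labeling scheme of size $O(f(n)\log n)$.
   Context: All graphs are finite, undirected, without loops or multiple edges; $\log$ is the base-2 logarithm; asymptotic notation is as $n\to\infty$. A class of graphs is a set of graphs closed under isomorphism. A class is monotone if it is closed under taking subgraphs (i.e., under vertex and edge deletions). For a class $\mathcal{X}$, $\mathcal{X}_n$ denotes the set of graphs in $\mathcal{X}$ with vertex set $[n]=\{1,\dots,n\}$, and $n\mapsto|\mathcal{X}_n|$ is the speed of $\mathcal{X}$. For a function $b:\mathbb{N}\to\mathbb{N}$, a $b(n)$-bit adjacency labeling scheme for $\mathcal{X}$ (an adjacency labeling scheme of size $b(n)$) is a pair (encoder, decoder) such that for any $n$-vertex graph $G\in\mathcal{X}_n$ the encoder assigns binary strings (labels) of length $b(n)$ to the vertices of $G$ so that the adjacency between any pair of vertices can be inferred by the decoder from their two labels only; the decoder depends on the class $\mathcal{X}$ but not on the graph $G$. The existence of a $b(n)$-bit labeling scheme is equivalent to the existence of a universal graph of size $2^{b(n)}$, i.e., a sequence $(U_n)_{n\in\mathbb{N}}$ of graphs such that $U_n$ has at most $2^{b(n)}$ vertices and every $n$-vertex graph in $\mathcal{X}$ is (isomorphic to) an induced subgraph of $U_n$. *)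

(* Defs.v *)
From HB Require Import structures.
From mathcomp Require Import all_boot all_order all_algebra.
From mathcomp Require Import all_classical all_reals all_analysis.

Set Implicit Arguments.
Unset Strict Implicit.
Unset Printing Implicit Defensive.

Import Order.TTheory GRing.Theory Num.Theory.
Import numFieldNormedType.Exports.

Local Open Scope ring_scope.

(* The edge set is a set of two-element sets, so that graphs are simple and
   equality of graphs on T is equality of edge sets. *)
Record graph (T : finType) := Graph {
  edges : {set {set T}};
  _ : [forall e in edges, #|e| == 2%N]
}.

HB.instance Definition _ (T : finType) := [isSub for @edges T].
HB.instance Definition _ (T : finType) := [Finite of graph T by <:].

Definition adj (T : finType) (G : graph T) : rel T :=
  fun u v => [set u; v]%SET \in edges G.

Definition graph_iso (T S : finType) (G : graph T) (H : graph S) : Prop :=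
  exists h : T -> S, bijective h /\ forall u v, adj G u v = adj H (h u) (h v).

(* H is a subgraph of G whose vertex set is the subset A of that of G. *)
Definition subgraph (T : finType) (A : {set T})
    (H : graph {x : T | x \in A}) (G : graph T) : Prop :=
  forall u v, adj H u v -> adj G (val u) (val v).

Definition graph_family := forall T : finType, graph T -> Prop.

Definition is_graph_class (X : graph_family) : Prop :=
  forall (T S : finType) (G : graph T) (H : graph S),
    graph_iso G H -> X T G -> X S H.

Definition monotone_graph_class (X : graph_family) : Prop :=
  forall (T : finType) (G : graph T) (A : {set T})
         (H : graph {x : T | x \in A}),
    subgraph H G -> X T G -> X _ H.

Definition speed (X : graph_family) (n : nat) : nat :=
  #|[set G : graph 'I_n | `[< X _ G >]]%SET|.

(* The decoder is given neither the graph nor its order n, and labels are not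
   required to be distinct. *)
Definition adjacency_labeling_scheme (X : graph_family) (b : nat -> nat) : Prop :=
  exists (enc : forall n, graph 'I_n -> 'I_n -> (b n).-tuple bool)
         (dec : seq bool -> seq bool -> bool),
    forall (n : nat) (G : graph 'I_n), X _ G ->
      forall u v : 'I_n, dec (enc n G u) (enc n G v) = adj G u v.

Definition log2 (R : realType) (x : R) : R := ln x / ln 2.

(* Main.v *)
Require Import Defs.
From HB Require Import structures.
From mathcomp Require Import all_boot all_order all_algebra.
From mathcomp Require Import all_classical all_reals all_analysis.
From mathcomp Require Import ring zify.

Set Implicit Arguments.
Unset Strict Implicit.
Unset Printing Implicit Defensive.

Import Order.TTheory GRing.Theory Num.Theory.
Import numFieldNormedType.Exports.

Local Open Scope classical_set_scope.
Local Open Scope ring_scope.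

(** A monotone class contains, with a graph with m edges, all 2 ^ m graphs
    obtained from it by deleting edges, so m is at most the logarithm of the
    speed.  Hence a k-vertex graph of the class with k large has at most
    C k f(k) edges, and some vertex of degree at most 2 C f(k).  Since the class
    is closed under taking subgraphs and f is non-decreasing, every subgraph of
    an n-vertex graph of the class has a vertex of degree O(f(n)); in other
    words, the graph is O(f(n))-degenerate ([degenerate_of_speed]).

    Removing vertices of small degree one at a time orients a d-degenerate graph
    with out-degrees at most d ([degenerate_orientation]).  A label that lists
    the identifiers of a vertex and of its out-neighbours then decides adjacency:
    two distinct vertices are adjacent iff one of them is listed by the other.
    This takes O(d log n) bits ([degenerate_labeling_scheme],
    [label_size_log]).

    Two points need care.  The decoder does not know n, so a label has to reveal
    the length of its identifiers.  And the number of bits has to be O(f(n) log n)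
    even when f vanishes identically: then large graphs of the class have no edge
    and their labels must be empty.  If f does not vanish identically, it is
    eventually bounded below by a positive constant, which absorbs the additive
    constants coming from the small subgraphs ([degeneracy_bound_bigO]). *)

(** * Subgraphs in monotone classes *)

Lemma adj_sym (T : finType) (G : graph T) : symmetric (adj G).
Proof. by move=> u v; rewrite /adj finset.setUC. Qed.

Lemma card_edge (T : finType) (G : graph T) (E : {set T}) :
  E \in edges G -> #|E| = 2%N.
Proof. by case: G => F /= /forall_inP hF /hF /eqP. Qed.

Lemma adj_irrefl (T : finType) (G : graph T) u : adj G u u = false.
Proof. by apply/negP => /card_edge; rewrite finset.setUid cards1. Qed.

Definition rel_edges (T : finType) (e : rel T) : {set {set T}} :=
  [set E : {set T} | (#|E| == 2%N) &&
                     [exists u, exists v, (E == [set u; v]) && e u v]]%SET.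

Lemma rel_edges_card2 (T : finType) (e : rel T) :
  [forall E in rel_edges e, #|E| == 2%N].
Proof. by apply/forall_inP => E; rewrite inE => /andP[]. Qed.

Definition graph_of_rel (T : finType) (e : rel T) : graph T :=
  Graph (rel_edges_card2 e).

Lemma adj_graph_of_rel (T : finType) (e : rel T) : symmetric e ->
  forall u v, adj (graph_of_rel e) u v = (u != v) && e u v.
Proof.
move=> esym u v; rewrite /adj inE cards2; case: (eqVneq u v) => //= uv.
apply/existsP/idP => [[x /existsP[y /andP[/eqP exy]]]|euv]; last first.
  by exists u; apply/existsP; exists v; rewrite eqxx.
have : u \in [set x; y]%SET by rewrite -exy set21.
have : v \in [set x; y]%SET by rewrite -exy set22.
rewrite !inE.
by case/orP => /eqP vE; case/orP => /eqP uE; move: uv; rewrite vE uE ?eqxx // esym.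
Qed.

(** Monotonicity speaks of graphs on subtypes {x | x \in A} only.  This form,
    for an arbitrary injective homomorphism, covers both uses below: deleting
    edges (h the identity) and passing to a set of k vertices renumbered by
    'I_k. *)
Lemma monotone_inj (X : graph_family) : is_graph_class X ->
  monotone_graph_class X ->
  forall (S T : finType) (h : S -> T) (H : graph S) (G : graph T),
  injective h -> (forall u v, adj H u v -> adj G (h u) (h v)) ->
  X T G -> X S H.
Proof.
move=> Xiso Xmon S T h H G hinj hadj XG.
pose A := [set h x | x in S]%SET.
have hA x : h x \in A by apply: imset_f.
pose k x : {y : T | y \in A} := Sub (h x) (hA x).
have kinj : injective k by move=> x y /(congr1 val) /hinj.
have kbij : bijective k.
  apply: inj_card_bij => //.
  by rewrite card_sig card_imset.
have [k' kK k'K] := kbij.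
pose K := graph_of_rel (fun x y => adj H (k' x) (k' y)).
have adjK x y : adj K x y = adj H (k' x) (k' y).
  rewrite adj_graph_of_rel; last by move=> a b; rewrite adj_sym.
  case: (eqVneq x y) => [->|//]; by rewrite adj_irrefl.
apply: (Xiso _ _ K).
  by exists k'; split => //; exists k.
apply: (Xmon _ G) => // x y; rewrite adjK => /hadj.
by rewrite -{2}(k'K x) -{2}(k'K y).
Qed.

(** * Few edges and low degrees from the speed *)

(** Distinct subsets of the edge set of G give distinct members of the class. *)
Lemma exp_edges_le_speed (X : graph_family) n (G : graph 'I_n) :
  is_graph_class X -> monotone_graph_class X -> X _ G ->
  (2 ^ #|edges G| <= speed X n)%N.
Proof.
move=> Xiso Xmon XG; rewrite -card_powerset.
pose del F : graph 'I_n := insubd G F.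
have edges_del F : F \in powerset (edges G) -> edges (del F) = F.
  rewrite inE => /fintype.subsetP FG; rewrite /del val_insubd ifT //.
  by apply/forall_inP => E /FG /card_edge ->.
have del_inj : {in powerset (edges G) &, injective del}.
  by move=> F1 F2 h1 h2 e; rewrite -(edges_del _ h1) e edges_del.
rewrite -(card_in_imset del_inj); apply: subset_leq_card.
apply/fintype.subsetP => H /imsetP[F hF ->]; rewrite inE; apply/asboolP.
apply: (monotone_inj Xiso Xmon (h := id)) XG => // u v.
rewrite /adj edges_del //; move: hF; rewrite inE => /fintype.subsetP; exact.
Qed.

Definition nbhd (T : finType) (G : graph T) (A : {set T}) (v : T) : {set T} :=
  [set u in A | adj G v u]%SET.

(** Double counting of incidences: the neighbours of v inject into the
    edges at v, and an edge has two end points. *)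
Lemma sum_degrees_le (T : finType) (G : graph T) :
  (\sum_v #|nbhd G [set: T]%SET v| <= 2 * #|edges G|)%N.
Proof.
have -> : (2 * #|edges G| = \sum_v #|[set E in edges G | v \in E]%SET|)%N.
  under eq_bigr do rewrite -sum1dep_card big_mkcondr /=.
  rewrite exchange_big /= mulnC -sum_nat_const; apply: eq_bigr => E hE.
  by rewrite -big_mkcond sum1_card (card_edge hE).
apply: leq_sum => v _.
have inj : {in nbhd G [set: T]%SET v &, injective (fun u => [set v; u]%SET)}.
  move=> x y; rewrite !inE /= => hx hy /setP /(_ x).
  rewrite !inE eqxx orbT; case: (eqVneq x v) => [xv|_ /esym /eqP //].
  by rewrite xv adj_irrefl in hx.
rewrite -(card_in_imset inj); apply/subset_leq_card/fintype.subsetP => E.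
move=> /imsetP[u]; rewrite !inE /= => hu ->.
by rewrite /adj in hu; rewrite hu !inE eqxx.
Qed.

Lemma low_degree_vertex (T : finType) (G : graph T) : (0 < #|T|)%N ->
  exists v, (#|T| * #|nbhd G [set: T]%SET v| <= 2 * #|edges G|)%N.
Proof.
move=> /card_gt0P[x0 _].
case: (arg_minnP (P := xpredT) (fun v => #|nbhd G [set: T]%SET v|) (erefl : xpredT x0)).
move=> v _ vmin; exists v; apply: leq_trans (sum_degrees_le G).
by rewrite -sum_nat_const; apply: leq_sum => u _; apply: vmin.
Qed.

(** The number m is the number of edges of the subgraph induced by A; the
    conclusion bounds the minimum degree of that subgraph by its average
    degree, in terms of the speed at #|A| and not at #|T|. *)
Lemma induced_low_degree (X : graph_family) (T : finType) (G : graph T)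
    (A : {set T}) :
  is_graph_class X -> monotone_graph_class X -> X _ G -> A != finset.set0 ->
  exists (v : T) (m : nat), [/\ v \in A, (2 ^ m <= speed X #|A|)%N
    & (#|A| * #|nbhd G A v| <= 2 * m)%N].
Proof.
move=> Xiso Xmon XG A0.
pose H := graph_of_rel (fun i j : 'I_#|A| => adj G (enum_val i) (enum_val j)).
have adjH i j : adj H i j = adj G (enum_val i) (enum_val j).
  rewrite adj_graph_of_rel; last by move=> a b; rewrite adj_sym.
  by case: (eqVneq i j) => [->|//]; rewrite adj_irrefl.
have XH : X _ H.
  apply: (monotone_inj Xiso Xmon (h := enum_val) _ _ XG); first exact: enum_val_inj.
  by move=> i j; rewrite adjH.
have [|i Hi] := low_degree_vertex H; first by rewrite card_ord card_gt0.
rewrite card_ord in Hi.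
exists (enum_val i), #|edges H|; split; first exact: enum_valP.
  exact: exp_edges_le_speed.
apply: leq_trans Hi; rewrite leq_mul2l; apply/orP; right.
rewrite -(card_imset _ (@enum_val_inj _ (mem A))).
apply/subset_leq_card/fintype.subsetP => u; rewrite inE => /andP[uA Gu].
apply/imsetP; exists (enum_rank_in uA u); last by rewrite enum_rankK_in.
by rewrite !inE adjH enum_rankK_in.
Qed.

(** * Degenerate graphs *)

Definition degenerate (d : nat) (T : finType) (G : graph T) :=
  forall A : {set T}, A != finset.set0 -> exists2 v, v \in A & (#|nbhd G A v| <= d)%N.

(** Here N v is the set of out-neighbours of v.  By induction on a set A of
    vertices: the edges of A at a vertex w of low degree in A are oriented out of
    w, the others as in the orientation obtained for A minus w. *)
Lemma degenerate_orientation (d : nat) (T : finType) (G : graph T) :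
  degenerate d G ->
  exists N : T -> {set T}, (forall v, #|N v| <= d)%N /\
    (forall u v, adj G u v = (v \in N u) || (u \in N v)).
Proof.
move=> dG.
suff H (A : {set T}) : exists N : T -> {set T}, (forall v, #|N v| <= d)%N /\
    {in A &, forall u v, adj G u v = (v \in N u) || (u \in N v)}.
  have [N [Nd NE]] := H [set: T]%SET; exists N; split => // u v.
  by apply: NE; rewrite inE.
move: {2}#|A| (leqnn #|A|) => n; elim: n A => [|n IH] A.
  rewrite leqn0 cards_eq0 => /eqP ->; exists (fun=> finset.set0); split.
    by move=> v; rewrite cards0.
  by move=> u v; rewrite inE.
move=> cA; have [->|A0] := eqVneq A finset.set0.
  by apply: IH; rewrite cards0.
have [w wA wd] := dG _ A0.
have [|N [Nd NE]] := IH (A :\ w)%SET.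
  by move: cA; rewrite (cardsD1 w A) wA.
exists (fun x => if x == w then nbhd G A w else N x :\ w)%SET; split.
  move=> v; case: ifP => // _; apply: leq_trans (Nd v).
  by apply: subset_leq_card; apply: subD1set.
move=> u v uA vA; case: (eqVneq u w) => [->|uw]; case: (eqVneq v w) => [->|vw].
- by rewrite !inE wA /= orbb.
- by rewrite !inE vA /= eqxx /= orbF.
- by rewrite !inE uA /= eqxx /= adj_sym.
- by rewrite NE ?inE ?uw ?vw.
Qed.

(** * Labels *)

(** The prefix gives the common length L of the words in unary, so that the
    sequence of words can be recovered without knowing L. *)
Definition pack (L : nat) (ws : seq (seq bool)) : seq bool :=
  nseq L true ++ false :: flatten ws.

Definition unpack (s : seq bool) : seq (seq bool) :=
  let L := index false s in
  let r := drop L.+1 s in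
  reshape (nseq (size r %/ L) L) r.

Lemma pack_shape L (ws : seq (seq bool)) : all (fun w => size w == L) ws ->
  shape ws = nseq (size ws) L.
Proof. by elim: ws => //= w ws IH /andP[/eqP -> /IH ->]. Qed.

Lemma size_pack L (ws : seq (seq bool)) : all (fun w => size w == L) ws ->
  size (pack L ws) = (L.+1 + size ws * L)%N.
Proof.
move=> h; rewrite /pack size_cat size_nseq /= size_flatten (pack_shape h).
by rewrite sumn_nseq mulnC addnS.
Qed.

Lemma packK L (ws : seq (seq bool)) : (0 < L)%N ->
  all (fun w => size w == L) ws -> unpack (pack L ws) = ws.
Proof.
move=> L0 h; rewrite /unpack.
have -> : index false (pack L ws) = L.
  rewrite /pack index_cat size_nseq /= addn0 ifF //.
  by apply/negbTE; rewrite mem_nseq andbF.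
rewrite drop_cat size_nseq ltnNge leqnSn /= subSnn /= drop0.
rewrite size_flatten (pack_shape h) sumn_nseq mulKn // -(pack_shape h).
exact: flattenK.
Qed.

(** The head of a list is the identifier of the vertex itself.  Two empty labels
    unpack to empty lists, whose default heads agree: they are never adjacent,
    as an edgeless graph requires. *)
Definition decode (s t : seq bool) : bool :=
  let ws := unpack s in let wt := unpack t in
  [&& head [::] ws != head [::] wt
    & (head [::] wt \in ws) || (head [::] ws \in wt)].

Definition id_len (n : nat) : nat := (trunc_log 2 n).+1.

(** Empty labels in the case d = 0 make the size O(d log n), without additive
    constant. *)
Definition label_size (d n : nat) : nat :=
  if d == 0%N then 0%N else ((id_len n).+1 + d.+1 * id_len n)%N.

Lemma exists_id n : exists c : 'I_n -> (id_len n).-tuple bool, injective c.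
Proof.
have h : (n <= #|{: (id_len n).-tuple bool}|)%N.
  rewrite card_tuple card_bool; apply: ltnW; exact: trunc_log_ltn.
exists (fun i => enum_val (widen_ord h i)) => i j /enum_val_inj /(congr1 val) /=.
exact: val_inj.
Qed.

Lemma degenerate_label (d n : nat) (G : graph 'I_n) : degenerate d G ->
  exists lab : 'I_n -> (label_size d n).-tuple bool,
    forall u v, decode (lab u) (lab v) = adj G u v.
Proof.
move=> /degenerate_orientation[N [Nd NE]]; rewrite /label_size.
case: ifP => [/eqP d0|_].
  exists (fun=> [tuple]) => u v; rewrite NE.
  have N0 w : N w = finset.set0.
    by apply/eqP; rewrite -cards_eq0 -leqn0 -d0.
  by rewrite !N0 !inE.
set L := id_len n; have [c cinj] := exists_id n.
(* All lists must have length d.+1; repeating the vertex itself is a harmless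
   padding because the decoder never accepts two equal identifiers. *)
pose l v := v :: enum (N v) ++ nseq (d - #|N v|) v.
pose cw x : seq bool := c x.
pose ws v := [seq cw x | x <- l v].
have wsL v : all (fun w => size w == L) (ws v).
  by apply/allP => _ /mapP[x _ ->]; rewrite size_tuple.
have szws v : size (ws v) = d.+1.
  by rewrite size_map /= size_cat size_nseq -cardE subnKC.
have szl v : size (pack L (ws v)) == (L.+1 + d.+1 * L)%N.
  by rewrite size_pack // szws.
exists (fun v => Tuple (szl v)) => u v.
have cwinj : injective cw.
  by move=> x y /val_inj /cinj.
have meml x y : (x \in l y) = (x == y) || (x \in N y).
  rewrite inE mem_cat mem_enum mem_nseq andbC.
  by case: (x == y); rewrite //= orbF.
have headE x : head [::] (ws x) = cw x by [].
rewrite /decode /= !packK // !headE (inj_eq cwinj) !(mem_map cwinj) !meml.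
case: (eqVneq u v) => [->|uv] /=; first by rewrite adj_irrefl.
by rewrite NE.
Qed.

Lemma degenerate_labeling_scheme (X : graph_family) (d : nat -> nat) :
  (forall n (G : graph 'I_n), X _ G -> degenerate (d n) G) ->
  adjacency_labeling_scheme X (fun n => label_size (d n) n).
Proof.
move=> Xd.
have lab n (G : graph 'I_n) : exists l : 'I_n -> (label_size (d n) n).-tuple bool,
    X _ G -> forall u v, decode (l u) (l v) = adj G u v.
  have [XG|nXG] := pselect (X _ G); last first.
    by exists (fun=> nseq_tuple _ false).
  by have [l lP] := degenerate_label (Xd n G XG); exists l.
by exists (fun n G => projT1 (cid (lab n G))), decode => n G; exact: (projT2 (cid (lab n G))).
Qed.

(** With L = 1 + trunc_log 2 n and d > 0, the size is at most 4 d L, and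
    L <= 2 log2 n because n > 1. *)
Lemma label_size_log (R : realType) (d n : nat) : (1 < n)%N ->
  (label_size d n)%:R <= 8 * d%:R * log2 n%:R :> R.
Proof.
move=> n1; set t := trunc_log 2 n.
have t1 : (0 < t)%N by rewrite trunc_log_gt0.
have tn : t%:R <= log2 n%:R :> R.
  rewrite /log2 ler_pdivlMr ?ln_gt0 ?ltr1n //.
  rewrite mulr_natl -lnXn // ler_ln ?posrE ?exprn_gt0 ?ltr0n ?(ltnW n1) //.
  by rewrite -natrX ler_nat trunc_logP // ltnW.
apply: (@le_trans _ _ (8 * d%:R * t%:R)); last by rewrite ler_wpM2l.
rewrite -!natrM ler_nat /label_size /id_len -/t.
by case: eqP => [->|]; nia.
Qed.

(** * Degeneracy from the speed *)

Lemma exp_le_powR (R : realType) (m s : nat) (x : R) :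
  (2 ^ m <= s)%N -> s%:R <= 2 `^ x -> m%:R <= x.
Proof.
move=> ms sx; have : 2 `^ m%:R <= 2 `^ x :> R.
  by apply: le_trans sx; rewrite powR_mulrn // -natrX ler_nat.
rewrite -ler_ln ?posrE ?powR_gt0 // !ln_powR ler_pM2r //.
by rewrite ln_gt0 // ltr1n.
Qed.

(** The first term is the average degree allowed by the bound C k f(k) on the
    number of edges, valid for k >= n0.  The second one handles the subgraphs on
    fewer than n0 vertices; it has to disappear when f(n) = 0 and n is large,
    where the graph is known to be edgeless. *)
Definition degeneracy_bound (R : realType) (f : R -> R) (C : R) (n0 n : nat) : nat :=
  (Num.truncn (2 * C * f n%:R) + (if (n < n0)%N || (0 < f n%:R)%R then n0 else 0))%N.

Lemma degenerate_of_speed (R : realType) (f : R -> R) (C : R) (n0 : nat)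
    (X : graph_family) (g : nat -> R) :
  (forall x : R, 0 <= x -> 0 <= f x) ->
  (forall x y : R, 0 <= x -> x <= y -> f x <= f y) ->
  is_graph_class X -> monotone_graph_class X ->
  (forall n : nat, (speed X n)%:R <= 2 `^ g n) ->
  0 < C -> (forall n, (n0 <= n)%N -> g n <= C * (n%:R * f n%:R)) ->
  forall n (G : graph 'I_n), X _ G -> degenerate (degeneracy_bound f C n0 n) G.
Proof.
move=> f_ge0 f_mono Xiso Xmon Xspeed C0 gC n G XG A A0.
rewrite /degeneracy_bound; case: ifPn => [_|].
  have [v [m [vA ms deg]]] := induced_low_degree Xiso Xmon XG A0.
  exists v => //; have cA : (0 < #|A|)%N by rewrite card_gt0.
  have [An0|n0A] := ltnP #|A| n0.
    apply: leq_trans (leq_addl _ _); apply: leq_trans (ltnW An0).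
    by apply/subset_leq_card/fintype.subsetP => u; rewrite inE => /andP[].
  apply: leq_trans (leq_addr _ _).
  have fA : f #|A|%:R <= f n%:R.
    by apply: f_mono => //; rewrite ler_nat -[leqRHS]card_ord max_card.
  rewrite truncn_ge_nat; last by rewrite !mulr_ge0 ?f_ge0 // ltW.
  have cAR : 0 < #|A|%:R :> R by rewrite ltr0n.
  have mC := le_trans (exp_le_powR ms (Xspeed _)) (gC _ n0A).
  move: deg; rewrite -(ler_nat R) !natrM => deg.
  rewrite -(ler_pM2l cAR); apply: le_trans deg _.
  apply: (@le_trans _ _ (2 * (C * (#|A|%:R * f n%:R)))).
    rewrite ler_pM2l //; apply: le_trans mC _.
    by rewrite !ler_pM2l.
  by rewrite le_eqVlt; apply/orP; left; apply/eqP; ring.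
rewrite negb_or -leqNgt -real_leNgt ?num_real // => /andP[n0n fn].
have := le_trans (exp_le_powR (exp_edges_le_speed Xiso Xmon XG) (Xspeed _)) (gC _ n0n).
have -> : f n%:R = 0 by apply/le_anti; rewrite fn f_ge0.
rewrite !mulr0 lern0 cards_eq0 => /eqP G0.
have /set0Pn[v vA] := A0; exists v => //.
suff -> : nbhd G A v = finset.set0 by rewrite cards0.
by apply/setP => u; rewrite !inE /adj G0 inE andbF.
Qed.

Lemma degeneracy_bound_bigO (R : realType) (f : R -> R) (C : R) (n0 : nat) :
  (forall x : R, 0 <= x -> 0 <= f x) ->
  (forall x y : R, 0 <= x -> x <= y -> f x <= f y) -> 0 < C ->
  exists K : R, exists N : nat, 0 < K /\
    forall n, (N <= n)%N -> (degeneracy_bound f C n0 n)%:R <= K * f n%:R.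
Proof.
move=> f_ge0 f_mono C0; have [[m fm]|nf] := pselect (exists m : nat, 0 < f m%:R).
  (* As f(m) <= f(n), the constant n0 is at most (n0 / f(m)) f(n). *)
  exists (2 * C + n0%:R / f m%:R), m; split.
    by rewrite ltr_wpDr ?divr_ge0 ?mulr_gt0 // ltW.
  move=> n mn; rewrite /degeneracy_bound natrD [leRHS]mulrDl; apply: lerD.
    by rewrite truncn_le !mulr_ge0 ?f_ge0 // ltW.
  have fmn : f m%:R <= f n%:R by apply: f_mono; rewrite ?ler_nat.
  rewrite mulrAC ler_pdivlMr //.
  apply: ler_pM => //; first exact: ltW.
  by rewrite ler_nat; case: ifP.
exists 1, n0; split => // n n0n.
have f0 : f n%:R = 0.
  apply/le_anti; rewrite f_ge0 // andbT real_leNgt ?num_real //.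
  by apply/negP => fn; apply: nf; exists n.
by rewrite /degeneracy_bound f0 ltxx ltnNge n0n /= !mulr0 truncn0.
Qed.

(** * The labeling scheme *)

Theorem proposition1p3 (R : realType) (f : R -> R)
  (f_ge0 : forall x : R, 0 <= x -> 0 <= f x)
  (f_nondecreasing : forall x y : R, 0 <= x -> x <= y -> f x <= f y)
  (X : graph_family)
  (X_class : is_graph_class X) (X_monotone : monotone_graph_class X)
  (g : nat -> R)
  (g_bigO : g =O_\oo (fun n : nat => n%:R * f n%:R))
  (X_speed : forall n : nat, (speed X n)%:R <= 2 `^ g n) :
  exists b : nat -> nat,
    (fun n : nat => (b n)%:R : R) =O_\oo (fun n : nat => f n%:R * log2 n%:R) /\
    adjacency_labeling_scheme X b.
Proof.
have /eqO_exP[C C0 [n0 _ gC]] := g_bigO.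
have {}gC n : (n0 <= n)%N -> g n <= C * (n%:R * f n%:R).
  move=> /gC /= /(le_trans (ler_norm _)) /le_trans; apply.
  by rewrite ger0_norm // mulr_ge0 // f_ge0.
pose d := degeneracy_bound f C n0.
exists (fun n => label_size (d n) n); split; last first.
  apply: degenerate_labeling_scheme.
  exact: degenerate_of_speed f_ge0 f_nondecreasing X_class X_monotone X_speed C0 gC.
have [K [N [K0 dK]]] := degeneracy_bound_bigO n0 f_ge0 f_nondecreasing C0.
apply/eqO_exP; exists (8 * K); first by rewrite mulr_gt0.
exists (maxn N 2) => //= n /=; rewrite geq_max => /andP[Nn n2].
have log_ge0 : 0 <= log2 n%:R :> R.
  by rewrite divr_ge0 // ln_ge0 // ler1n // ltnW.
have flog_ge0 : 0 <= f n%:R * log2 n%:R by apply: mulr_ge0 log_ge0; exact: f_ge0.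
rewrite ger0_norm // (ger0_norm flog_ge0) [leRHS]mulrA -[8 * K * _]mulrA.
apply: le_trans (label_size_log R (d n) n2) _.
by apply: (ler_wpM2r log_ge0); rewrite ler_pM2l // dK.
Qed.
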